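(* Let $R$ be an augmented Noetherian semiperfect algebra with Jacobson radical $J$, let $\delta:\mathbb{N}\to\mathbb{N}$ be a strictly increasing function, and let $$\xi:\quad 0\to K\to M\to N\to 0$$ be a short exact sequence in the category of quasi-$\delta$-Koszul $R$-modules (i.e. a short exact sequence of $R$-modules in which $K$, $M$, $N$ are all quasi-$\delta$-Koszul). Then $JK=K\cap JM$ if and only if the minimal Horseshoe Lemma holds with respect to $\xi$.
   Context: Modules are left modules. $R$ is an associative unital algebra over a field. Semiperfect means every finitely generated $R$-module has a (finitely generated) projective cover. Augmented means that the canonical projection $R\to R/J$ is split by an algebra homomorphism $R/J\to R$. Given an exact sequence, $K$ is regarded as a submodule of $M$. A projective resolution $\cdots\to P_1\xrightarrow{d_1}P_0\xrightarrow{d_0}M\to 0$ is minimal if $P_0\to M$ and each $P_n\to \ker d_{n-1}$ ($n\ge1$) are projective covers. Quasi-$\delta$-Koszul module: a finitely generated $R$-module $M$ such that, for a minimal projective resolution $\cdots\to P_n\xrightarrow{d_n}\cdots\to P_1\xrightarrow{d_1}P_0\xrightarrow{d_0}M\to0$, for all $n\ge0$ one has $\ker d_n\subseteq J^{\delta(n+1)-\delta(n)}P_n$ and $J\ker d_n=\ker d_n\cap J^{\delta(n+1)-\delta(n)+1}P_n$. Here $\mathbb{N}=\{0,1,2,\dots\}$. The minimal Horseshoe Lemma holds with respect to $\xi: 0\to K\to M\to N\to0$ if for any given minimal projective resolutions $\mathcal{P}_*\to K\to0$ and $\mathcal{Q}_*\to N\to0$ there are a minimal projective resolution $\mathcal{L}_*\to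 M\to 0$ and a short exact sequence of complexes $0\to\mathcal{P}_*\to\mathcal{L}_*\to\mathcal{Q}_*\to0$ such that the resulting diagram over $\xi$ (with the augmentations to $K$, $M$, $N$) is commutative with exact rows and columns. *)

(* Defs.v *)
(* Submodules and ideals are classical sets (`set V := V -> Prop`); rings may be
   infinite and noncommutative, and modules are left modules. *)
From HB Require Import structures.
From mathcomp Require Import all_boot all_order all_algebra.
From mathcomp Require Import boolp classical_sets.

Set Implicit Arguments.
Unset Strict Implicit.
Unset Printing Implicit Defensive.

Import GRing.Theory.
Local Open Scope classical_set_scope.
Local Open Scope ring_scope.

Section Modules.
Variable R : pzRingType.
Implicit Types (V W P M : lmodType R).

Definition submodule V (U : set V) : Prop := GRing.submod_closed [in U].

Definition left_ideal (I : set R) : Prop := submodule (I : set R^o).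

Definition fin_gen V (U : set V) : Prop :=
  exists (n : nat) (e : 'I_n -> V),
    U = [set \sum_(i < n) c i *: e i | c in [set: 'I_n -> R]].

Definition fg_module V : Prop := fin_gen [set: V].

Definition left_noetherian : Prop :=
  forall I : set R, left_ideal I -> fin_gen (I : set R^o).

Definition maximal_left_ideal (m : set R) : Prop :=
  [/\ left_ideal m, m <> setT &
      forall I : set R, left_ideal I -> m `<=` I -> I = m \/ I = setT].

Definition jacobson : set R :=
  \bigcap_(m in [set m | maximal_left_ideal m]) m.

Definition ideal_smul V (I : set R) (U : set V) : set V :=
  [set x | exists (n : nat) (a : 'I_n -> R) (u : 'I_n -> V),
     [/\ forall i, I (a i), forall i, U (u i) & x = \sum_(i < n) a i *: u i]].

(* J ^ 0 = R *)
Definition jacobson_pow (n : nat) : set R :=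
  iter n (fun I : set R => ideal_smul jacobson (I : set R^o)) setT.

Definition kernel V W (f : {linear V -> W}) : set V := f @^-1` [set 0].

Definition short_exact V M W (i : {linear V -> M}) (p : {linear M -> W}) :
    Prop :=
  [/\ injective i, range i = kernel p & range p = setT].

Definition projective P : Prop :=
  forall (A B : lmodType R) (g : {linear A -> B}) (f : {linear P -> B}),
    range g = setT -> exists h : {linear P -> A}, forall x, g (h x) = f x.

Definition superfluous V (U : set V) : Prop :=
  submodule U /\
  forall X : set V, submodule X ->
    [set u + x | u in U & x in X] = setT -> X = setT.

(* f, seen as a map onto the submodule U of M, is a projective cover of U *)
Definition projective_cover_of P M (f : {linear P -> M}) (U : set M) : Prop :=
  [/\ projective P, range f = U & superfluous (kernel f)].

Definition semiperfect : Prop :=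
  forall M, fg_module M ->
    exists (P : lmodType R) (f : {linear P -> M}),
      fg_module P /\ projective_cover_of f setT.

(* Augmented complexes ... -> P_2 -> P_1 -> P_0 -> M: `res_diff n` is the map
   d_(n+1) : P_(n+1) -> P_n, and `res_aug` is d_0 : P_0 -> M. *)
Record augmented_seq M := AugmentedSeq {
  res_mod : nat -> lmodType R;
  res_diff : forall n, {linear res_mod n.+1 -> res_mod n};
  res_aug : {linear res_mod 0%N -> M} }.

(* ker d_n, a submodule of P_n *)
Definition res_ker M (P : augmented_seq M) (n : nat) : set (res_mod P n) :=
  match n return set (res_mod P n) with
  | 0%N => kernel (res_aug P)
  | m.+1 => kernel (res_diff P m)
  end.

Definition projective_resolution M (P : augmented_seq M) : Prop :=
  [/\ forall n, projective (res_mod P n),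
      range (res_aug P) = setT &
      forall n, range (res_diff P n) = @res_ker M P n].

Definition minimal_resolution M (P : augmented_seq M) : Prop :=
  [/\ projective_resolution P,
      projective_cover_of (res_aug P) setT &
      forall n, projective_cover_of (res_diff P n) (@res_ker M P n)].

Definition quasi_koszul (delta : nat -> nat) M : Prop :=
  fg_module M /\
  exists P : augmented_seq M, minimal_resolution P /\
    forall n : nat,
      let k := (delta n.+1 - delta n)%N in
      let Z := @res_ker M P n in
      Z `<=` ideal_smul (jacobson_pow k) [set: res_mod P n] /\
      ideal_smul jacobson Z =
        Z `&` ideal_smul (jacobson_pow k.+1) [set: res_mod P n].

Definition minimal_horseshoe (K M N : lmodType R)
    (i : {linear K -> M}) (p : {linear M -> N}) : Prop :=
  forall (P : augmented_seq K) (Q : augmented_seq N),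
    minimal_resolution P -> minimal_resolution Q ->
    exists (L : augmented_seq M)
        (f : forall n, {linear res_mod P n -> res_mod L n})
        (g : forall n, {linear res_mod L n -> res_mod Q n}),
      [/\ minimal_resolution L,
          forall n, short_exact (f n) (g n),
          forall n x, f n (res_diff P n x) = res_diff L n (f n.+1 x),
          forall n x, g n (res_diff L n x) = res_diff Q n (g n.+1 x) &
          (forall x, res_aug L (f 0%N x) = i (res_aug P x)) /\
          (forall x, res_aug Q (g 0%N x) = p (res_aug L x))].

End Modules.

Arguments jacobson R : clear implicits.
Arguments jacobson_pow R n : clear implicits.

(* pi presents A as the quotient algebra R/J (a surjective algebra homomorphism
   with kernel J), and sigma is an algebra homomorphism splitting pi. *)
Definition augmented (k : fieldType) (R : algType k) : Prop :=
  exists (A : algType k) (pi : {lrmorphism R -> A}) (sigma : {lrmorphism A -> R}),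
    [/\ range pi = setT, pi @^-1` [set 0] = jacobson R & cancel sigma pi].

(* Main.v *)
(* Adding to the differential of P + Q a map t from Q to P, built degree by degree
   from projectivity, always yields a projective resolution L of M that is an
   extension of Q by P; the question is whether L is minimal. Let B_n be the n-th
   syzygy of M in L, and A_n that of K in P. Degreewise splitting shows that
   JA_n = A_n `&` JB_n forces B_(n+1) into JL_n, so that B_(n+1) is superfluous by
   Nakayama's lemma (L_n is finitely generated since R is noetherian). By uniqueness
   of minimal resolutions B_(n+1) then lies in J^k L_n with
   k = delta (n+1) - delta n, so A_(n+1) `&` JB_(n+1) lies in
   A_(n+1) `&` J^(k+1) P_n = JA_(n+1), and the induction goes on.
   Conversely, if L is minimal, write i x in JM as the image of some y in JL_0. The
   syzygies form an exact sequence, so y may be corrected by an element of B_1, which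
   is contained in JL_0, to come from P_0, and then from JP_0 by splitting. *)
Require Import Defs.
From HB Require Import structures.
From mathcomp Require Import all_boot all_order all_algebra.
From mathcomp Require Import boolp classical_sets.

Set Implicit Arguments.
Unset Strict Implicit.
Unset Printing Implicit Defensive.

Import GRing.Theory.
Local Open Scope classical_set_scope.
Local Open Scope ring_scope.

(** * Submodules, linear maps and lifting from projective modules *)

Section Submodules.
Variable R : pzRingType.
Implicit Types (P Q V W : lmodType R).

Lemma submoduleP V (U : set V) :
  submodule U <-> U 0 /\ forall a u v, U u -> U v -> U (a *: u + v).
Proof.
split=> [[U0 UL]|[U0 UL]].
  by split=> [|a u v uU vU]; [exact: set_mem | apply/set_mem/UL; exact: mem_set].
split=> [|a u v /set_mem uU /set_mem vU]; first exact: mem_set.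
by apply: mem_set; exact: UL.
Qed.

Section Closure.
Variables (V : lmodType R) (U : set V) (subU : submodule U).

Lemma submod0 : U 0. Proof. by case/submoduleP: subU. Qed.

Lemma submodD u v : U u -> U v -> U (u + v).
Proof. by move=> uU vU; rewrite -[u]scale1r; case/submoduleP: subU => _; apply. Qed.

Lemma submodZ a u : U u -> U (a *: u).
Proof.
move=> uU; rewrite -[_ *: _]addr0; case/submoduleP: subU => _; apply=> //.
exact: submod0.
Qed.

Lemma submodN u : U u -> U (- u).
Proof. by move=> uU; rewrite -scaleN1r; exact: submodZ. Qed.

Lemma submodB u v : U u -> U v -> U (u - v).
Proof. by move=> uU vU; apply: submodD => //; exact: submodN. Qed.

Lemma submod_sum n (u : 'I_n -> V) : (forall i, U (u i)) -> U (\sum_(i < n) u i).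
Proof. by move=> uU; apply: big_ind => //; [exact: submod0 | exact: submodD]. Qed.

End Closure.

Section SubmoduleType.
Variables (V : lmodType R) (U : set V).

(* The closure proof is a parameter only so that the instances can depend on it. *)
Definition submod_type of submodule U := {x : V | x \in U}.
HB.instance Definition _ (sU : submodule U) := [isSub of submod_type sU for @sval _ _].
HB.instance Definition _ (sU : submodule U) := [Choice of submod_type sU by <:].
HB.instance Definition _ (sU : submodule U) :=
  GRing.SubChoice_isSubLmodule.Build R V [in U] (submod_type sU)
    (GRing.submod_closed_semi sU).
End SubmoduleType.

Section LinearMap.
Variables (V W : lmodType R) (f : V -> W) (lin_f : linear f).
(** A named constant carries the linear structure, so that any function with a proof of linearity
    can be bundled on the spot. *)
Definition linear_map_fun := f.
HB.instance Definition _ := GRing.isLinear.Build R V W *:%R linear_map_fun lin_f.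
Definition linear_map : {linear V -> W} := linear_map_fun.
End LinearMap.

Lemma submodule_setT V : submodule [set: V].
Proof. by apply/submoduleP. Qed.

Lemma submodule_image V W (f : {linear V -> W}) (U : set V) :
  submodule U -> submodule (f @` U).
Proof.
move=> subU; apply/submoduleP; split; first by exists 0; [exact: submod0|exact: linear0].
move=> a _ _ [u uU <-] [v vU <-]; exists (a *: u + v); last by rewrite linearP.
by apply: submodD => //; exact: submodZ.
Qed.

Lemma submodule_preimage V W (f : {linear V -> W}) (U : set W) :
  submodule U -> submodule (f @^-1` U).
Proof.
move=> subU; apply/submoduleP; split; first by rewrite /= linear0; exact: submod0.
move=> a u v /= uU vU; rewrite linearP.
by apply: submodD => //; exact: submodZ.
Qed.

Lemma submodule_kernel V W (f : {linear V -> W}) : submodule (kernel f).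
Proof.
apply: submodule_preimage; apply/submoduleP; split=> // a u v -> ->.
by rewrite scaler0 addr0.
Qed.

Lemma submodule_range V W (f : {linear V -> W}) : submodule (range f).
Proof. by apply: submodule_image; exact: submodule_setT. Qed.

Lemma submodule_setI V (U U' : set V) :
  submodule U -> submodule U' -> submodule (U `&` U').
Proof.
move=> sU sU'; apply/submoduleP; split; first by split; exact: submod0.
by move=> a u v [? ?] [? ?]; split; apply: submodD => //; exact: submodZ.
Qed.

(** Projectivity lifts only along surjections, so both maps are corestricted to the range of [g],
    made into a module by [submod_type]. *)
Lemma projective_lift P V W (g : {linear V -> W}) (f : {linear P -> W}) :
  projective P -> range f `<=` range g ->
  exists h : {linear P -> V}, forall x, g (h x) = f x.
Proof.
move=> projP fg; have sub := submodule_range g.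
have linf : linear (fun x => exist _ (f x) (mem_set (fg _ (imageT f x)))
    : submod_type sub).
  by move=> a u v; apply: val_inj; rewrite /= linearP.
have ling : linear (fun x => exist _ (g x) (mem_set (imageT g x)) : submod_type sub).
  by move=> a u v; apply: val_inj; rewrite /= linearP.
have [|h hP] := projP _ _ (linear_map ling) (linear_map linf).
  apply/seteqP; split=> // -[y yS] _; have [x _ xy] := set_mem yS.
  by exists x => //; apply: val_inj.
by exists h => x; have /(congr1 val) := hP x.
Qed.

Lemma projective_pair P Q : projective P -> projective Q ->
  projective (P * Q)%type.
Proof.
move=> projP projQ A B g f gsurj.
have l1 : linear (fun x : P => f (x, 0)).
  by move=> a u v; rewrite -linearP /=; congr (f _); congr pair; rewrite /= ?scaler0 ?addr0.
have l2 : linear (fun x : Q => f (0, x)).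
  by move=> a u v; rewrite -linearP /=; congr (f _); congr pair; rewrite /= ?scaler0 ?addr0.
have [h1 h1P] := projP _ _ g (linear_map l1) gsurj.
have [h2 h2P] := projQ _ _ g (linear_map l2) gsurj.
have lh : linear (fun x : P * Q => h1 x.1 + h2 x.2).
  by move=> a u v; rewrite !linearP /= scalerDr addrACA.
exists (linear_map lh) => -[x y] /=.
rewrite /linear_map_fun /= linearD h1P h2P /= /linear_map_fun -linearD.
by congr (f _); congr pair; rewrite /= ?add0r ?addr0.
Qed.

End Submodules.

(** * Products [IU], powers of the Jacobson radical, and Nakayama's lemma *)

Section IdealSmul.
Variable R : pzRingType.
Implicit Types (V W : lmodType R) (I : set R).

Lemma ideal_smul0 V I (U : set V) : ideal_smul I U 0.
Proof.
by exists 0%N, (fun=> 0), (fun=> 0); split=> [[]|[]|] //; rewrite big_ord0.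
Qed.

Lemma ideal_smulD V I (U : set V) x y :
  ideal_smul I U x -> ideal_smul I U y -> ideal_smul I U (x + y).
Proof.
move=> [m [a [u [aI uU ->]]]] [n [b [v [bI vU ->]]]].
exists (m + n)%N,
  (fun j => match split j with inl j => a j | inr j => b j end),
  (fun j => match split j with inl j => u j | inr j => v j end).
split=> [j|j|]; try by case: (split j).
rewrite big_split_ord /=; congr (_ + _); apply: eq_bigr => j _.
  by rewrite (unsplitK (inl j)).
by rewrite (unsplitK (inr j)).
Qed.

Lemma ideal_smul_sum V I (U : set V) n (x : 'I_n -> V) :
  (forall j, ideal_smul I U (x j)) -> ideal_smul I U (\sum_(j < n) x j).
Proof. by move=> xP; apply: big_ind => //; [exact: ideal_smul0 | exact: ideal_smulD]. Qed.

Lemma ideal_smulZ V I (U : set V) a u : I a -> U u -> ideal_smul I U (a *: u).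
Proof.
by move=> Ia Uu; exists 1%N, (fun=> a), (fun=> u); split=> //; rewrite big_ord1.
Qed.

Lemma ideal_smul_ind V I (U : set V) (X : set V) :
  X 0 -> (forall x y, X x -> X y -> X (x + y)) ->
  (forall a u, I a -> U u -> X (a *: u)) -> ideal_smul I U `<=` X.
Proof.
move=> X0 XD XZ _ [n [a [u [aI uU ->]]]].
by apply: big_ind => // i _; exact: XZ.
Qed.

Lemma ideal_smulN V I (U : set V) x :
  submodule U -> ideal_smul I U x -> ideal_smul I U (- x).
Proof.
move=> subU [n [a [u [aI uU ->]]]]; exists n, a, (fun j => - u j); split=> //.
  by move=> j; exact: submodN.
by rewrite -sumrN; apply: eq_bigr => j _; rewrite scalerN.
Qed.

Lemma ideal_smulS V I (U U' : set V) :
  U `<=` U' -> ideal_smul I U `<=` ideal_smul I U'.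
Proof.
move=> UU'; apply: ideal_smul_ind => [|x y|a u Ia /UU' Uu].
- exact: ideal_smul0.
- exact: ideal_smulD.
- exact: ideal_smulZ.
Qed.

Lemma ideal_smul_image V W (f : {linear V -> W}) I (U : set V) :
  f @` ideal_smul I U = ideal_smul I (f @` U).
Proof.
apply/seteqP; split.
  move=> _ [_ [n [a [u [aI uU ->]]]] <-]; exists n, a, (f \o u); split=> //.
    by move=> j; exists (u j).
  by rewrite linear_sum; apply: eq_bigr => j _; rewrite linearZ.
apply: ideal_smul_ind => [|_ _ [x xI <-] [y yI <-]|a _ Ia [u uU <-]].
- by exists 0; [exact: ideal_smul0 | exact: linear0].
- by exists (x + y); [exact: ideal_smulD | exact: linearD].
- by exists (a *: u); [exact: ideal_smulZ | exact: linearZ].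
Qed.

Lemma ideal_smul_linear V W (f : {linear V -> W}) I x :
  ideal_smul I setT x -> ideal_smul I setT (f x).
Proof.
move=> xI; apply: (@ideal_smulS _ _ (range f)) => //.
by rewrite -ideal_smul_image; exists x.
Qed.

Local Notation J := (jacobson R).

Lemma left_ideal_jacobson : left_ideal J.
Proof.
apply/submoduleP; split=> [m [] mI _ _|a u v uJ vJ m mmax]; first exact: (submod0 mI).
case: (mmax) => mI _ _; apply: (submodD mI); last exact: vJ.
by apply: (submodZ mI); exact: uJ.
Qed.

Lemma jacobson_smul_pow V n (U : set V) :
  U `<=` ideal_smul (jacobson_pow R n) setT ->
  ideal_smul J U `<=` ideal_smul (jacobson_pow R n.+1) setT.
Proof.
move=> UJ; apply: ideal_smul_ind => [|x y|a u Ja /UJ[m [b [v [bI _ ->]]]]].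
- exact: ideal_smul0.
- exact: ideal_smulD.
rewrite scaler_sumr; apply: ideal_smul_sum => j; rewrite scalerA.
by apply: ideal_smulZ => //; exact: (@ideal_smulZ R^o _ (jacobson_pow R n) _ _ Ja (bI j)).
Qed.

Lemma jacobson_powS_smul V n :
  ideal_smul (jacobson_pow R n.+1) [set: V] `<=` ideal_smul J setT.
Proof.
apply: ideal_smul_ind => [|x y|_ u [m [a [b [aJ _ ->]]]] _].
- exact: ideal_smul0.
- exact: ideal_smulD.
rewrite scaler_suml; apply: ideal_smul_sum => j.
by rewrite -scalerA; exact: ideal_smulZ.
Qed.

(** Zorn's lemma on the left ideals that contain [I] and omit 1; properness in this form passes to
    unions of chains. *)
Lemma maximal_left_ideal_above (I : set R) : left_ideal I -> ~ I 1 ->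
  exists2 m, maximal_left_ideal m & I `<=` m.
Proof.
move=> idI I1.
(* The disjunct [set0] accommodates the union of the empty chain. *)
pose proper (A : set R) := A = set0 \/ [/\ left_ideal A, I `<=` A & ~ A 1].
have [F Fproper Ftot|m [mproper mmax]] := @Zorn_bigcup _ proper.
  have [[A FA [a Aa]]|F0] := pselect (exists2 A, F A & A !=set0); last first.
    left; apply/seteqP; split=> // x [A FA Ax].
    by apply: F0; exists A => //; exists x.
  have ideals B : F B -> B !=set0 -> [/\ left_ideal B, I `<=` B & ~ B 1].
    by move=> /Fproper[->[]|].
  right; split.
  - apply/submoduleP; split.
      by exists A => //; apply: submod0; case: (ideals A FA _) => //; exists a.
    move=> c u v [B FB Bu] [C FC Cv].
    have [BC|CB] := Ftot _ _ FB FC.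
      exists C => //; have [] := ideals C FC _; first by exists v.
      by move=> lC _ _; apply: submodD => //; apply: submodZ => //; exact: BC.
    exists B => //; have [] := ideals B FB _; first by exists u.
    by move=> lB _ _; apply: submodD => //; [exact: submodZ | exact: CB].
  - by move=> x Ix; exists A => //; case: (ideals A FA _) => [|_ + _]; [exists a|exact].
  - by move=> [B FB B1]; case: (ideals B FB _) => [|_ _]; [exists 1|exact].
have [m0|[idm Im m1]] := mproper.
  (* The empty set is not maximal, because [I] is admissible and contains 0. *)
  exfalso; apply: (mmax I); last by right; split.
  rewrite m0; split=> // /(_ 0); apply.
  exact: (submod0 idI).
exists m => //; split=> // [mT|A idA mA]; first by apply: m1; rewrite mT.
have [A1|A1] := pselect (A 1).
  right; apply/seteqP; split=> // x _; rewrite -[x]mulr1.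
  exact: (submodZ idA).
left; apply: contrapT => Am; apply: (mmax A).
  by split=> // Am'; apply: Am; apply/seteqP; split.
by right; split=> // x /Im /mA.
Qed.

(** Otherwise the left ideal generated by [1 - a] lies in a maximal left ideal, which also contains
    [a] and hence 1. *)
Lemma jacobson_left_inverse a : J a -> exists s, s * (1 - a) = 1.
Proof.
move=> Ja; pose I : set R := [set s * (1 - a) | s in setT].
have idI : left_ideal I.
  apply/submoduleP; split; first by exists 0 => //; rewrite mul0r.
  move=> c _ _ [s _ <-] [t _ <-]; exists (c * s + t) => //.
  by rewrite mulrDl -mulrA.
apply: contrapT => no; have I1 : ~ I 1 by move=> [s _ s1]; apply: no; exists s.
have [m mmax Im] := maximal_left_ideal_above idI I1.
have m1a : m (1 - a) by apply: Im; exists 1 => //; rewrite mul1r.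
case: (mmax) => idm mT _; apply: mT; apply/seteqP; split=> // x _.
rewrite -[x]mulr1; apply: (submodZ idm); rewrite -(subrK a 1).
by apply: (submodD idm) => //; exact: Ja.
Qed.

(** [jacobson] is an intersection of left ideals, so stability on the right is a separate property;
    for an augmented algebra it follows from [J] being the kernel of a ring morphism. *)
Hypothesis jacobsonMr : forall a r, J a -> J (a * r).

(** The generators of V modulo X are eliminated one at a time. Since V = JV + X, the first one is
    congruent to a combination of all of them with coefficients in J; its own coefficient [b ord0]
    is moved to the left, where [1 - b ord0] has a left inverse. *)
Lemma nakayama_span V n (e : 'I_n -> V) (X : set V) : submodule X ->
  (forall v, exists c : 'I_n -> R, X (v - \sum_(i < n) c i *: e i)) ->
  (forall v, exists2 y, ideal_smul J [set: V] y & X (v - y)) ->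
  X = setT.
Proof.
move=> subX; elim: n e => [|n IHn] e espan XJ.
  apply/seteqP; split=> // v _; have [c] := espan v.
  by rewrite big_ord0 subr0.
apply: (IHn (fun i => e (lift ord0 i))) => // v.
(* Modulo X, elements of JV are combinations of the generators with coefficients in J; right
   stability of J enters here. *)
have JV : ideal_smul J [set: V] `<=`
    [set y | exists2 b : 'I_n.+1 -> R, (forall i, J (b i)) &
       X (y - \sum_(i < n.+1) b i *: e i)].
  apply: ideal_smul_ind => [|x y [b bJ bX] [c cJ cX]|a u Ja _].
  - exists (fun=> 0) => [i|]; first exact: (submod0 left_ideal_jacobson).
    rewrite big1 ?subr0; first exact: submod0.
    by move=> i _; rewrite scale0r.
  - exists (fun i => b i + c i) => [i|]; first exact: (submodD left_ideal_jacobson).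
    rewrite (eq_bigr _ (fun i _ => scalerDl _ _ _)) big_split /= opprD addrACA.
    exact: submodD.
  - have [c cX] := espan u; exists (fun i => a * c i) => [i|]; first exact: jacobsonMr.
    rewrite (eq_bigr _ (fun i _ => esym (scalerA _ _ _))) -scaler_sumr -scalerBr.
    exact: submodZ.
have [y /JV[b bJ yX] eyX] := XJ (e ord0).
have [s s1] := jacobson_left_inverse (bJ ord0).
have e0X : X (e ord0 - \sum_(i < n) (s * b (lift ord0 i)) *: e (lift ord0 i)).
  have := submodZ subX s (submodD subX eyX yX).
  rewrite addrA subrK big_ord_recl opprD addrA.
  rewrite -{1}[e ord0]scale1r -scalerBl scalerBr scalerA s1 scale1r scaler_sumr.
  by rewrite (eq_bigr _ (fun i _ => scalerA _ _ _)).
have [c vX] := espan v.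
(* These coefficients come from substituting the relation for [e ord0] into the expansion of [v]. *)
exists (fun i => c (lift ord0 i) + c ord0 * (s * b (lift ord0 i))) => //.
have := submodD subX vX (submodZ subX (c ord0) e0X).
rewrite big_ord_recl scalerBr scaler_sumr.
rewrite (eq_bigr _ (fun i _ => scalerDl _ _ _)) big_split /=.
rewrite (eq_bigr _ (fun i _ => scalerA _ _ _)).
by rewrite -addrA !opprD addrACA addNr add0r.
Qed.

Lemma superfluous_jacobson V (U : set V) : fg_module V -> submodule U ->
  U `<=` ideal_smul J setT -> superfluous U.
Proof.
move=> [n [e eT]] subU UJ; split=> // X subX UX.
apply: (nakayama_span (e := e)) => // v.
  have : [set: V] v by []; rewrite eT => -[c _ <-]; exists c => //.
  by rewrite subrr; exact: submod0.
have [u /UJ uJ [x xX <-]] : [set u + x | u in U & x in X] v by rewrite UX.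
exists u => //.
by rewrite addrC addKr.
Qed.

End IdealSmul.

(** * Finite generation: extensions, noetherian rings and projective covers *)

Section FinGen.
Variable R : pzRingType.
Implicit Types (P M V W : lmodType R).

Lemma mem_gen V n (e : 'I_n -> V) i :
  [set \sum_(j < n) c j *: e j | c in [set: 'I_n -> R]] (e i).
Proof.
exists (fun j => (j == i)%:R) => //.
rewrite (bigD1 i) //= eqxx scale1r big1 ?addr0 // => j /negPf ->.
exact: scale0r.
Qed.

Lemma fin_gen_cat V (U : set V) m n (e : 'I_m -> V) (f : 'I_n -> V) :
  submodule U -> (forall i, U (e i)) -> (forall i, U (f i)) ->
  (forall u, U u -> exists (a : 'I_m -> R) (b : 'I_n -> R),
     u = \sum_(i < m) a i *: e i + \sum_(i < n) b i *: f i) ->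
  fin_gen U.
Proof.
move=> subU eU fU ef; exists (m + n)%N,
  (fun j => match split j with inl j => e j | inr j => f j end).
apply/seteqP; split=> [u /ef[a [b ->]]|_ [c _ <-]]; last first.
  by apply: submod_sum => // j; apply: submodZ => //; case: (split j).
exists (fun j => match split j with inl j => a j | inr j => b j end) => //.
rewrite big_split_ord /=; congr (_ + _); apply: eq_bigr => j _.
  by rewrite (unsplitK (inl j)).
by rewrite (unsplitK (inr j)).
Qed.

Lemma fg_extension V M W (f : {linear V -> M}) (g : {linear M -> W}) :
  short_exact f g -> fg_module V -> fg_module W -> fg_module M.
Proof.
move=> [_ fg gT] [m [e eT]] [n [w wT]].
have /choice[y yw] : forall i, exists y, g y = w i.
  by move=> i; have : range g (w i) by [rewrite gT]; move=> [y _ <-]; exists y.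
apply: (@fin_gen_cat _ _ _ _ (f \o e) y) => //; first exact: submodule_setT.
move=> u _; have : [set: W] (g u) by []; rewrite wT => -[b _ bu].
have : kernel g (u - \sum_(i < n) b i *: y i).
  rewrite /kernel /= linearB linear_sum -bu; apply/eqP; rewrite subr_eq0.
  by apply/eqP/eq_bigr => i _; rewrite linearZ /= yw.
rewrite -fg => -[v _ fv]; have : [set: V] v by []; rewrite eT => -[a _ av].
exists a, b; rewrite -[LHS](subrK (\sum_(i < n) b i *: y i)) -fv -av linear_sum.
by congr (_ + _); apply: eq_bigr => i _; rewrite linearZ.
Qed.

(** Induction on the number of generators. The coefficients of the first generator in elements of U
    form a left ideal, finitely generated by hypothesis, and the elements of U in the span of the
    other generators fall under the induction hypothesis. *)
Lemma noetherian_fin_gen V (U : set V) : left_noetherian R ->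
  fg_module V -> submodule U -> fin_gen U.
Proof.
move=> noethR [n [e eT]].
(* Only the inclusion of U in the span is kept: in the induction U and the span shrink while V
   stays. *)
have {eT} : U `<=` [set \sum_(i < n) c i *: e i | c in [set: 'I_n -> R]].
  by rewrite -eT.
elim: n U e => [|n IHn] U e Ue subU.
  apply: (@fin_gen_cat _ U 0 0 e e) => //; try by case.
  move=> u /Ue[c _ <-]; exists c, c; by rewrite !big_ord0 addr0.
pose tail (c : 'I_n -> R) := \sum_(i < n) c i *: e (lift ord0 i).
have tailP a c d : tail (fun i => a * c i + d i) = a *: tail c + tail d.
  rewrite /tail scaler_sumr -big_split; apply: eq_bigr => i _ /=.
  by rewrite scalerDl scalerA.
pose U' := U `&` [set tail c | c in setT].
have subU' : submodule U'.
  apply: submodule_setI => //; apply/submoduleP; split.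
    exists (fun=> 0) => //; rewrite /tail big1 // => i _; exact: scale0r.
  by move=> a _ _ [c _ <-] [d _ <-]; exists (fun i => a * c i + d i).
have [|n' [e' eU']] := IHn U' (fun i => e (lift ord0 i)) _ subU'.
  by move=> u [].
pose I : set R := [set r | exists c, U (r *: e ord0 + tail c)].
have idI : left_ideal I.
  apply/submoduleP; split.
    exists (fun=> 0); rewrite /tail big1 => [|i _]; last exact: scale0r.
    by rewrite scale0r addr0; exact: submod0.
  move=> a r s [c rU] [d sU]; exists (fun i => a * c i + d i).
  rewrite tailP scalerDl addrACA -scalerA -scalerDr.
  by apply: submodD => //; exact: submodZ.
have [m [r' rI]] := noethR I idI; pose r : 'I_m -> R := r'.
have Ir j : I (r j).
  by rewrite rI; exact: mem_gen.
pose c j := projT1 (cid (Ir j)).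
have cU j : U (r j *: e ord0 + tail (c j)) by exact: (projT2 (cid (Ir j))).
have e'U j : U' (e' j).
  by rewrite eU'; exact: mem_gen.
apply: (@fin_gen_cat _ U _ _ (fun j => r j *: e ord0 + tail (c j)) e') => //.
  by move=> j; case: (e'U j).
move=> u Uu; have [a _ au] := Ue _ Uu.
have : I (a ord0) by exists (fun i => a (lift ord0 i)); move: Uu; rewrite -au big_ord_recl.
rewrite rI => -[b _ ba].
have tail_span k (d : 'I_k -> R) (f : 'I_k -> 'I_n -> R) :
    \sum_(j < k) d j *: tail (f j) = tail (fun i => \sum_(j < k) d j * f j i).
  under eq_bigr do rewrite /tail scaler_sumr.
  rewrite exchange_big; apply: eq_bigr => i _ /=.
  by rewrite scaler_suml; apply: eq_bigr => j _; rewrite scalerA.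
(* The leading coefficient of [u] is the combination of the [r j] by the [b j], so the terms in
   [e ord0] cancel. *)
have : U' (u - \sum_(j < m) b j *: (r j *: e ord0 + tail (c j))).
  split.
    apply: submodB => //; apply: submod_sum => // j; exact: submodZ.
  under eq_bigr do rewrite scalerDr scalerA.
  rewrite big_split /= -scaler_suml ba -au big_ord_recl tail_span.
  rewrite opprD addrACA subrr add0r -/(tail (fun i => a (lift ord0 i))).
  exists (fun i => -1 * (\sum_(j < m) b j * c j i) + a (lift ord0 i)) => //.
  by rewrite tailP scaleN1r addrC.
rewrite eU' => -[d _ du]; exists b, d.
by rewrite du addrC subrK.
Qed.

Lemma cover_fg P M (f : {linear P -> M}) (U : set M) :
  projective_cover_of f U -> fin_gen U -> fg_module P.
Proof.
move=> [_ fU [_ sup]] [n [e eU]].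
have /choice[p pe] : forall i, exists x, f x = e i.
  move=> i; have : U (e i) by rewrite eU; exact: mem_gen.
  by rewrite -fU => -[x _ <-]; exists x.
exists n, p; symmetry; apply: sup.
  apply/submoduleP; split.
    by exists (fun=> 0) => //; rewrite big1 // => i _; exact: scale0r.
  move=> a _ _ [c _ <-] [d _ <-]; exists (fun i => a * c i + d i) => //.
  rewrite scaler_sumr -big_split; apply: eq_bigr => i _ /=.
  by rewrite scalerDl scalerA.
apply/seteqP; split=> // x _.
have : U (f x) by rewrite -fU; exists x.
rewrite eU => -[c _ cx].
exists (x - \sum_(i < n) c i *: p i).
  rewrite /kernel /= linearB linear_sum -cx; apply/eqP; rewrite subr_eq0.
  by apply/eqP/eq_bigr => i _; rewrite linearZ /= pe.
by exists (\sum_(i < n) c i *: p i); [exists c | rewrite subrK].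
Qed.

End FinGen.

(** Dependent choice in a family of types, as needed for maps whose source and target vary with the
    degree. *)
Lemma dependent_chain (S : nat -> Type) (Rel : forall n, S n -> S n.+1 -> Prop)
    (s0 : S 0%N) :
  (forall n s, exists s', @Rel n s s') ->
  exists f : forall n, S n, f 0%N = s0 /\ forall n, Rel n (f n) (f n.+1).
Proof.
move=> step; pose next n s := projT1 (cid (step n s)).
exists (nat_rect S s0 next); split=> // n /=.
exact: (projT2 (cid (step n _))).
Qed.

(** * Minimal resolutions, their uniqueness, and the horseshoe construction *)

Section Resolutions.
Variable R : pzRingType.
Implicit Types (P Q K M N V W : lmodType R).

Local Notation J := (jacobson R).

Lemma submodule_res_ker M (P : augmented_seq M) n : submodule (@res_ker _ _ P n).
Proof. by case: n => [|n]; exact: submodule_kernel. Qed.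

Lemma minimal_resolutionP M (P : augmented_seq M) :
  minimal_resolution P <->
  projective_resolution P /\ forall n, superfluous (@res_ker _ _ P n).
Proof.
split=> [[resP [_ _ sup0] covP]|[[projP augP diffP] sup]].
  by split=> // -[|n] //=; case: (covP n).
split=> [//||n]; first by split=> //; exact: (sup 0%N).
by split=> //; exact: (sup n.+1).
Qed.

Lemma cover_iso (L' T' L T : lmodType R) (dL : {linear L' -> L}) (dT : {linear T' -> T})
    (h : {linear L -> T}) :
  projective L' -> projective T' -> superfluous (kernel dL) ->
  superfluous (kernel dT) -> injective h -> h @` range dL = range dT ->
  exists h' : {linear L' -> T'},
    [/\ injective h', range h' = setT &
        forall x, kernel dL x <-> kernel dT (h' x)].
Proof.
move=> projL projT [_ supL] [_ supT] inj_h hd.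
have [|h' h'P] := @projective_lift _ _ _ _ dT (h \o dL) projL.
  by move=> _ [x _ <-]; rewrite -hd; exists (dL x) => //; exists x.
have kerP x : kernel dL x <-> kernel dT (h' x).
  rewrite /kernel /= h'P /=; split=> [->|]; first exact: linear0.
  by rewrite -(linear0 h) => /inj_h.
have h'T : range h' = setT.
  apply: supT; first exact: submodule_range.
  apply/seteqP; split=> // y _.
  have : range dT (dT y) by exists y.
  rewrite -hd => -[_ [x _ <-] hx].
  exists (y - h' x); first by rewrite /kernel /= linearB h'P /= hx subrr.
  by exists (h' x); [exists x | rewrite subrK].
have [s sP] := projT _ _ h' (linear_map (f := id) (fun a u v => erefl)) h'T.
have sT : range s = setT.
  apply: supL; first exact: submodule_range.
  apply/seteqP; split=> // x _; exists (x - s (h' x)).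
    by apply/kerP; rewrite /kernel /= linearB sP subrr linear0.
  by exists (s (h' x)); [exists (h' x) | rewrite subrK].
exists h'; split=> // x y.
have [[a _ <-] [b _ <-]] : range s x /\ range s y by rewrite sT.
by rewrite !sP /= /linear_map_fun => ->.
Qed.

(** Minimality is required only up to degree [n], because the horseshoe resolution is shown to be
    minimal one degree at a time. *)
Lemma resolution_iso M (L T : augmented_seq M) n :
  projective_resolution L -> projective_resolution T ->
  (forall m, (m <= n)%N -> superfluous (@res_ker _ _ L m)) ->
  (forall m, (m <= n)%N -> superfluous (@res_ker _ _ T m)) ->
  exists h : {linear res_mod L n -> res_mod T n},
    [/\ injective h, range h = setT &
        forall x, @res_ker _ _ L n x <-> @res_ker _ _ T n (h x)].
Proof.
move=> [projL augL diffL] [projT augT diffT].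
elim: n => [|n IHn] supL supT.
  have lin_id : linear (@id M) by [].
  apply: (@cover_iso _ _ _ _ (res_aug L) (res_aug T) (linear_map lin_id)) => //.
  - exact: (supL 0%N).
  - exact: (supT 0%N).
  - by rewrite augL augT image_id.
have [m mn|m mn|h [inj_h hT kerh]] := IHn; [exact/supL/leqW|exact/supT/leqW|].
apply: (@cover_iso _ _ _ _ (res_diff L n) (res_diff T n) h) => //.
- exact: (supL n.+1).
- exact: (supT n.+1).
- rewrite diffL diffT; apply/seteqP; split=> [_ [x /kerh + <-]|y yT] //.
  have : range h y by rewrite hT.
  by move=> [x _ xy]; exists x => //; apply/kerh; rewrite xy.
Qed.

Lemma ideal_smul_inj V W (h : {linear V -> W}) (I : set R) (U : set V) x :
  injective h -> ideal_smul I (h @` U) (h x) -> ideal_smul I U x.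
Proof. by move=> inj_h; rewrite -ideal_smul_image => -[y yI /inj_h <-]. Qed.

Lemma koszul_condition_iso V W (h : {linear V -> W}) (Z : set V) (Y : set W) k :
  injective h -> range h = setT -> (forall x, Z x <-> Y (h x)) ->
  Y `<=` ideal_smul (jacobson_pow R k) setT /\
    ideal_smul J Y = Y `&` ideal_smul (jacobson_pow R k.+1) setT ->
  Z `<=` ideal_smul (jacobson_pow R k) setT /\
    ideal_smul J Z = Z `&` ideal_smul (jacobson_pow R k.+1) setT.
Proof.
move=> inj_h hT ZY [YJ JY].
have hZ : h @` Z = Y.
  apply/seteqP; split=> [_ [x /ZY + <-]|y Yy] //.
  have : range h y by rewrite hT.
  by move=> [x _ xy]; exists x => //; apply/ZY; rewrite xy.
have smulT I x : ideal_smul I setT (h x) -> ideal_smul I setT x.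
  by rewrite -hT; exact: ideal_smul_inj.
split=> [x /ZY/YJ|]; first exact: smulT.
apply/seteqP; split=> x.
  move=> xJ; have : ideal_smul J Y (h x) by rewrite -hZ -ideal_smul_image; exists x.
  by rewrite JY => -[/ZY Zx /smulT].
move=> [Zx xJ]; apply: (ideal_smul_inj inj_h); rewrite hZ JY; split; first exact/ZY.
exact: ideal_smul_linear.
Qed.

(** The definition provides one suitable minimal resolution; uniqueness transports its condition in
    degree [n] to any resolution that is minimal up to that degree. *)
Lemma quasi_koszul_res_ker delta M (L : augmented_seq M) n :
  quasi_koszul delta M -> projective_resolution L ->
  (forall m, (m <= n)%N -> superfluous (@res_ker _ _ L m)) ->
  let k := (delta n.+1 - delta n)%N in let Z := @res_ker _ _ L n in
  Z `<=` ideal_smul (jacobson_pow R k) setT /\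
  ideal_smul J Z = Z `&` ideal_smul (jacobson_pow R k.+1) setT.
Proof.
move=> [_ [T [/minimal_resolutionP[resT supT] koszulT]]] resL supL.
have [|h [inj_h hT kerh]] := resolution_iso resL resT supL; first by move=> m _.
exact: (koszul_condition_iso inj_h hT kerh (koszulT n)).
Qed.

Lemma quasi_koszul_res_ker_jacobson delta M (L : augmented_seq M) n :
  {homo delta : m n / (m < n)%N} ->
  quasi_koszul delta M -> minimal_resolution L ->
  @res_ker _ _ L n `<=` ideal_smul J setT.
Proof.
move=> homo_delta qkM /minimal_resolutionP[resL supL].
have [m _|+ _] := @quasi_koszul_res_ker _ _ _ n qkM resL; first exact: supL.
(* Strict growth of [delta] makes the exponent at least 1, so the power of J acts inside JV. *)
have /prednK <- : (0 < delta n.+1 - delta n)%N by rewrite subn_gt0 homo_delta.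
by move=> kerJ x /kerJ; exact: jacobson_powS_smul.
Qed.

Lemma minimal_resolution_fg M (P : augmented_seq M) n :
  left_noetherian R -> fg_module M -> minimal_resolution P ->
  fg_module (res_mod P n).
Proof.
move=> noethR fgM [_ cov0 covP].
elim: n => [|n fgn]; first exact: cover_fg cov0 _.
apply: cover_fg (covP n) _; apply: noetherian_fin_gen => //.
exact: submodule_res_ker.
Qed.

(** With [s] a section of [g], the map [y - s (g y)] takes values in the range of [f] and so lifts
    through [f]. *)
Lemma short_exact_retraction V W Q (f : {linear V -> W}) (g : {linear W -> Q}) :
  projective W -> projective Q -> short_exact f g ->
  exists r : {linear W -> V}, cancel f r.
Proof.
move=> projW projQ [inj_f fg gT].
have [s sP] := projQ _ _ g (linear_map (f := id) (fun a u v => erefl)) gT.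
have lin_e : linear (fun y => y - s (g y)).
  by move=> a u v; rewrite !linearP /= addrACA -scalerDr.
have [|r rP] := @projective_lift _ _ _ _ f (linear_map lin_e) projW.
  move=> _ [y _ <-]; rewrite fg /kernel /= /linear_map_fun linearB sP /=.
  exact: subrr.
exists r => x; apply: inj_f; rewrite rP /= /linear_map_fun.
have -> : g (f x) = 0 by have : range f (f x) by [exists x]; rewrite fg.
by rewrite linear0 subr0.
Qed.

(** The differential of L sends (a, b) to (d a + t b, d b), so that it squares to zero as soon as d
    t = - t d; the augmentation is that of P followed by [i], plus a lift [s] of that of Q. *)
Lemma horseshoe_resolution K M N (i : {linear K -> M}) (p : {linear M -> N})
    (P : augmented_seq K) (Q : augmented_seq N) :
  short_exact i p -> projective_resolution P -> projective_resolution Q ->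
  exists (L : augmented_seq M)
      (f : forall n, {linear res_mod P n -> res_mod L n})
      (g : forall n, {linear res_mod L n -> res_mod Q n}),
    [/\ projective_resolution L,
        forall n, short_exact (f n) (g n),
        forall n x, f n (res_diff P n x) = res_diff L n (f n.+1 x),
        forall n x, g n (res_diff L n x) = res_diff Q n (g n.+1 x) &
        (forall x, res_aug L (f 0%N x) = i (res_aug P x)) /\
        (forall x, res_aug Q (g 0%N x) = p (res_aug L x))].
Proof.
move=> [inj_i ip pT] [projP augP diffP] [projQ augQ diffQ].
have pi0 x : p (i x) = 0 by have : range i (i x) by [exists x]; rewrite ip.
have kerP n x : @res_ker _ _ P n (res_diff P n x) by rewrite -diffP; exists x.
have kerQ n x : @res_ker _ _ Q n (res_diff Q n x) by rewrite -diffQ; exists x.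
have [s sP] := projQ 0%N _ _ p (res_aug Q) pT.
(* The sign makes the augmentation of L vanish on the boundaries (t b, d b). *)
have lin0 : linear (fun b => - s (res_diff Q 0 b)).
  by move=> a u v; rewrite !linearP.
have [|t0 t0P] := @projective_lift _ _ _ _ (i \o res_aug P) (linear_map lin0) (projQ 1%N).
  move=> _ [b _ <-] /=; rewrite /linear_map_fun.
  have : kernel p (- s (res_diff Q 0 b)).
    by rewrite /kernel /= linearN sP (kerQ 0%N b) oppr0.
  rewrite -ip => -[x _ <-]; have : range (res_aug P) x by rewrite augP.
  by move=> [y _ <-]; exists y.
have t0ker b : @res_ker _ _ P 0 (t0 (res_diff Q 1 b)).
  apply: inj_i; rewrite linear0; move: (t0P (res_diff Q 1 b)) => /= ->.
  by rewrite /linear_map_fun (kerQ 1%N b) !linear0.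
(* Each map is stored with the fact that it sends boundaries to cycles, which is what allows the
   next one to be lifted. *)
pose S n := {t : {linear res_mod Q n.+1 -> res_mod P n} |
  forall b, @res_ker _ _ P n (t (res_diff Q n.+1 b))}.
pose Rel n (t : S n) (t' : S n.+1) :=
  forall b, res_diff P n (sval t' b) = - sval t (res_diff Q n.+1 b).
have [n [t tker]|t [t0E tP]] := @dependent_chain S Rel (exist _ t0 t0ker).
  have lint : linear (fun b => - t (res_diff Q n.+1 b)).
    by move=> a u v; rewrite !linearP.
  have [|t' t'P] := @projective_lift _ _ _ _ (res_diff P n) (linear_map lint) (projQ n.+2).
    move=> _ [b _ <-]; rewrite diffP /= /linear_map_fun.
    by apply: submodN; [exact: submodule_res_ker | exact: tker].
  have t'ker b : @res_ker _ _ P n.+1 (t' (res_diff Q n.+2 b)).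
    rewrite /= /kernel /= t'P /= /linear_map_fun (kerQ n.+2 b).
    by rewrite !linear0.
  by exists (exist _ t' t'ker) => b; rewrite t'P.
have lin_aug : linear (fun x : res_mod P 0 * res_mod Q 0 => i (res_aug P x.1) + s x.2).
  by move=> a u v; rewrite !linearP /= scalerDr addrACA.
have lin_diff n : linear (fun x : res_mod P n.+1 * res_mod Q n.+1 =>
    (res_diff P n x.1 + sval (t n) x.2, res_diff Q n x.2)).
  by move=> a u v; rewrite !linearP /= addrACA -scalerDr.
pose L := @AugmentedSeq R M (fun n => (res_mod P n * res_mod Q n)%type)
  (fun n => linear_map (lin_diff n)) (linear_map lin_aug).
have lin_f n : linear (fun x : res_mod P n => (x, 0 : res_mod Q n)).
  by move=> a u v; congr pair; rewrite /= ?scaler0 ?addr0.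
have lin_g n : linear (fun x : res_mod P n * res_mod Q n => x.2) by [].
exists L, (fun n => linear_map (lin_f n)), (fun n => linear_map (lin_g n)).
split.
- split=> /=.
  + by move=> n; exact: projective_pair.
  + apply/seteqP; split=> // m _.
    have [b _ bm] : range (res_aug Q) (p m) by rewrite augQ.
    have : kernel p (m - s b) by rewrite /kernel /= linearB sP bm subrr.
    rewrite -ip => -[x _ xm]; have [a _ ax] : range (res_aug P) x by rewrite augP.
    by exists (a, b) => //=; rewrite /linear_map_fun /= ax xm subrK.
  + have dd0 a b : res_aug L (res_diff L 0 (a, b)) = 0.
      rewrite /= /linear_map_fun /= linearD (kerP 0%N a) add0r.
      by have := t0P b; rewrite t0E /= => ->; rewrite /linear_map_fun addNr.
    have dd n a b : res_diff L n (res_diff L n.+1 (a, b)) = 0.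
      rewrite /= /linear_map_fun /= linearD (kerP n.+1 a) add0r tP addNr.
      by rewrite (kerQ n.+1 b).
    (* (a, b) = d (0, b') + (c, 0) with d b' = b and then c a cycle of P *)
    have exact_at n (a : res_mod P n) (b : res_mod Q n) : @res_ker _ _ Q n b ->
        (forall b', res_diff Q n b' = b -> @res_ker _ _ P n (a - sval (t n) b')) ->
        range (res_diff L n) (a, b).
      rewrite -diffQ => -[b' _ bb'] /(_ b' bb') kerc.
      have : range (res_diff P n) (a - sval (t n) b') by rewrite [range _]diffP.
      move=> [c _ cP].
      by exists (c, b') => //=; rewrite /linear_map_fun /= cP subrK bb'.
    case=> [|n]; apply/seteqP; split=> [_ [[a b] _ <-]|[a b]].
    * exact: dd0.
    * rewrite /= /kernel /= /linear_map_fun /= => ab0; apply: exact_at => [|b' bb'].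
        (* Applying [p] to the vanishing sum of [i (res_aug P a)] and [s b] shows that [b] is a
           cycle. *)
        by rewrite /= /kernel /= -sP -[s b](addKr (i (res_aug P a))) ab0 addr0
          linearN pi0 oppr0.
      apply: inj_i; rewrite !linearB linear0 /=; have := t0P b'.
      by rewrite t0E /= => ->; rewrite /linear_map_fun bb' opprK.
    * exact: dd.
    * rewrite /= /kernel /= /linear_map_fun /= => -[ab0 b0].
      apply: exact_at => // b' bb'.
      by rewrite /= /kernel /= linearB tP bb' opprK.
- move=> n; split.
  + by move=> x y [].
  + apply/seteqP; split=> [_ [x _ <-]|[x y] /= y0] //.
    have {}y0 : y = 0 := y0.
    by exists x => //; rewrite y0.
  + by apply/seteqP; split=> // y _; exists (0, y).
- by move=> n x; rewrite /= /linear_map_fun /= !linear0 addr0.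
- by [].
- split=> [x|x] /=; rewrite /linear_map_fun /=; first by rewrite linear0 addr0.
  by rewrite linearD pi0 add0r sP.
Qed.

(** Modulo some [z] in JL', an element of the kernel of [dL] is [f w]. Then [dL] maps [f w] to
    [dL (- z)], which lies in J times the range, so the last hypothesis, the purity of the syzygies,
    gives [dP w = dP w'] with [w'] in JP'; the difference is in the kernel of [dP]. *)
Lemma horseshoe_kernel_jacobson (K L Q P' L' Q' : lmodType R) (u : {linear K -> L})
    (dP : {linear P' -> K}) (dL : {linear L' -> L}) (dQ : {linear Q' -> Q})
    (f : {linear P' -> L'}) (g : {linear L' -> Q'}) :
  short_exact f g -> (forall x, dL (f x) = u (dP x)) ->
  (forall y, kernel dL y -> kernel dQ (g y)) ->
  kernel dP `<=` ideal_smul J setT -> kernel dQ `<=` ideal_smul J setT ->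
  (forall x, ideal_smul J (range dL) (u (dP x)) ->
     ideal_smul J (range dP) (dP x)) ->
  kernel dL `<=` ideal_smul J setT.
Proof.
move=> [inj_f fg gT] dLf dLg kerP kerQ reflJ y yL.
have : ideal_smul J [set: Q'] (g y) by apply: kerQ; exact: dLg.
rewrite -gT -ideal_smul_image => -[z zJ gz].
have : kernel g (y - z) by rewrite /kernel /= linearB gz subrr.
rewrite -fg => -[w _ fw].
have : ideal_smul J (range dP) (dP w).
  apply: reflJ; rewrite -dLf fw linearB yL sub0r -ideal_smul_image -linearN.
  by exists (- z) => //; apply: ideal_smulN => //; exact: submodule_setT.
rewrite -ideal_smul_image => -[w' w'J dw'].
rewrite -(subrK z y) -fw; apply: ideal_smulD => //; apply: ideal_smul_linear.
rewrite -(subrK w' w); apply: ideal_smulD => //; apply: kerP.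
by rewrite /kernel /= linearB dw' subrr.
Qed.

(** * The two implications of the equivalence *)

Section MinimalHorseshoe.
Variables (delta : nat -> nat) (K M N : lmodType R).
Variables (i : {linear K -> M}) (p : {linear M -> N}).
Hypothesis homo_delta : {homo delta : m n / (m < n)%N}.
Hypothesis exact_ip : short_exact i p.
Hypotheses (qkK : quasi_koszul delta K) (qkM : quasi_koszul delta M)
  (qkN : quasi_koszul delta N).

Lemma pure_of_minimal_horseshoe : minimal_horseshoe i p ->
  i @` ideal_smul J [set: K] = range i `&` ideal_smul J [set: M].
Proof.
move=> horse; apply/seteqP; split=> [_ [x xJ <-]|_ [[x _ <-] ixJ]].
  by split; [exists x | exact: ideal_smul_linear].
exists x => //.
have [_ [P [minP _]]] := qkK; have [_ [Q [minQ _]]] := qkN.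
have [L [f [g [minL fg fd gd [fa ga]]]]] := horse P Q minP minQ.
have [[projL augL diffL] _ _] := minL; have [[_ augP _] _ _] := minP.
have [[projQ augQ diffQ] _ _] := minQ; have [inj_i ip _] := exact_ip.
have [r fK] := short_exact_retraction (projL 0%N) (projQ 0%N) (fg 0%N).
have [inj_f fg0 _] := fg 0%N; have [_ _ gT] := fg 1%N.
move: ixJ; rewrite -augL -ideal_smul_image => -[y yJ yx].
have : @res_ker _ _ Q 0 (g 0%N y).
  rewrite /= /kernel /= ga yx.
  by have : range i (i x) by [exists x]; rewrite ip.
(* The boundary of [l] is the correction of [y]: it has the same image in degree 0 of Q, and the
   augmentation of L kills it. *)
rewrite -diffQ => -[b _ bg]; have [l _ lb] : range (g 1%N) b by rewrite gT.
have zker : @res_ker _ _ L 0 (res_diff L 0 l) by rewrite -diffL; exists l.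
have : kernel (g 0%N) (y - res_diff L 0 l).
  by rewrite /kernel /= linearB gd lb bg subrr.
rewrite -fg0 => -[w _ fw].
have -> : x = res_aug P w.
  by apply: inj_i; rewrite -fa fw linearB zker subr0.
apply: ideal_smul_linear; rewrite -[w]fK; apply: ideal_smul_linear; rewrite fw.
apply: ideal_smulD => //; apply: ideal_smulN; first exact: submodule_setT.
exact: (quasi_koszul_res_ker_jacobson homo_delta qkM minL zker).
Qed.

Lemma minimal_horseshoe_of_pure : left_noetherian R ->
  (forall a r, J a -> J (a * r)) ->
  i @` ideal_smul J [set: K] = range i `&` ideal_smul J [set: M] ->
  minimal_horseshoe i p.
Proof.
move=> noethR JMr pure P Q minP minQ; have [inj_i ip _] := exact_ip.
have [[resP supP] [resQ supQ]] :=
  (iffLR (minimal_resolutionP P) minP, iffLR (minimal_resolutionP Q) minQ).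
have [L [f [g [resL fg fd gd [fa ga]]]]] := horseshoe_resolution exact_ip resP resQ.
exists L, f, g; split=> //; apply/minimal_resolutionP; split=> // n.
have [projL augL diffL] := resL; have [_ augP diffP] := resP.
have [projQ _ _] := resQ.
have fgL m : fg_module (res_mod L m).
  apply: (fg_extension (fg m)); apply: minimal_resolution_fg => //.
    by case: qkK.
  by case: qkN.
have kerPJ m := quasi_koszul_res_ker_jacobson (n := m) homo_delta qkK minP.
have kerQJ m := quasi_koszul_res_ker_jacobson (n := m) homo_delta qkN minQ.
elim/ltn_ind: n => n supL; apply: superfluous_jacobson => //.
  exact: submodule_res_ker.
case: n supL => [|n] supL /=.
  apply: (horseshoe_kernel_jacobson (u := i) (dP := res_aug P) (dQ := res_aug Q)
    (fg 0%N)) => //.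
    by move=> y yL; rewrite /kernel /= ga yL linear0.
  rewrite augL augP => x xJ.
  have : (range i `&` ideal_smul J setT) (i (res_aug P x)) by split=> //; exists (res_aug P x).
  by rewrite -pure => -[y yJ /inj_i <-].
apply: (horseshoe_kernel_jacobson (u := f n) (dP := res_diff P n)
  (dQ := res_diff Q n) (fg n.+1)) => //.
- by move=> y yL; rewrite /kernel /= -gd yL linear0.
rewrite diffL diffP => x xJ.
(* The equality in the condition on K turns membership in J times the syzygy into membership in a
   power of J times [res_mod P n], which can be tested in L through the retraction of [f n]. *)
have [|_ ->] := @quasi_koszul_res_ker _ _ P n qkK resP; first by move=> m _.
have [kerLJ _] := @quasi_koszul_res_ker _ _ L n qkM resL supL.
split; first by rewrite -diffP; exists x.
have [r fK] := short_exact_retraction (projL n) (projQ n) (fg n).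
by rewrite -[res_diff P n x]fK; apply: ideal_smul_linear; exact: jacobson_smul_pow xJ.
Qed.

End MinimalHorseshoe.
End Resolutions.

(** The augmentation presents J as the kernel of a ring morphism, hence as a two-sided ideal. *)
Lemma jacobson_mulr (k : fieldType) (R : algType k) (a r : R) :
  augmented R -> jacobson R a -> jacobson R (a * r).
Proof.
by move=> [A [pi [_ [_ <- _]]]] /= a0; rewrite rmorphM /= a0 mul0r.
Qed.

Theorem theoremA (k : fieldType) (R : algType k) (delta : nat -> nat)
    (K M N : lmodType R) (i : {linear K -> M}) (p : {linear M -> N}) :
  augmented R -> left_noetherian R -> semiperfect R ->
  {homo delta : m n / (m < n)%N} ->
  short_exact i p ->
  quasi_koszul delta K -> quasi_koszul delta M -> quasi_koszul delta N ->
  (i @` ideal_smul (jacobson R) [set: K] =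
     range i `&` ideal_smul (jacobson R) [set: M]
   <-> minimal_horseshoe i p).
Proof.
move=> augR noethR _ homo_delta exact_ip qkK qkM qkN; split.
  apply: (minimal_horseshoe_of_pure homo_delta) => // a r.
  exact: jacobson_mulr.
exact: (pure_of_minimal_horseshoe homo_delta).
Qed.
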